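(* For every integer $n\ge 2$, there is a CNF formula that encodes the independent-set property of $\mathcal{I}_n$ and has at most $26\,n^2\log_2 n$ clauses.
   Context: For $n\ge 2$, $\mathcal{I}_n$ is the graph whose vertices are all integer intervals $[i,j]$ with $1\le i<j\le n$, with an edge between two distinct intervals whenever they intersect. For a formula $F$ and an assignment $\tau$ to some of its variables, $F|_\tau$ is obtained by deleting every clause satisfied by $\tau$ and deleting from the remaining clauses every literal falsified by $\tau$. Given a graph $G=(V,E)$, variables $X=\{x_v : v\in V\}$ and a (possibly empty) set $Y$ of auxiliary variables, a formula $F$ with variable set $X\cup Y$ encodes the independent-set property of $G$ if for every assignment $\tau: X\to\{\bot,\top\}$, $F|_\tau$ is satisfiable if and only if $\{v\in V : \tau(x_v)=\top\}$ is an independent set of $G$. *)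

(* Defs.v *)
From mathcomp Require Import all_boot all_order all_algebra.
From mathcomp Require Import reals exp.

Set Implicit Arguments.
Unset Strict Implicit.
Unset Printing Implicit Defensive.

Record sgraph := SGraph {
  vertex :> finType;
  adj : rel vertex;
  adj_sym : symmetric adj;
  adj_irrefl : irreflexive adj }.

Definition independent (G : sgraph) (S : {set G}) : bool :=
  [forall u in S, forall v in S, ~~ adj u v].

(* The literal (x, true) is the variable x, and (x, false) is its negation.
   The ambient type T only lists the variables that may occur in a formula;
   the number of clauses of F : cnf T is #|F|. *)
Definition literal (T : finType) : finType := (T * bool)%type.
Definition clause (T : finType) : finType := {set literal T}.
Definition cnf (T : finType) : finType := {set clause T}.

(* tau x = None means that tau does not assign the variable x. *)
Definition passignment (T : finType) : Type := T -> option bool.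

Definition lit_satisfied (T : finType) (tau : passignment T) (l : literal T)
  : bool := tau l.1 == Some l.2.

Definition lit_falsified (T : finType) (tau : passignment T) (l : literal T)
  : bool := tau l.1 == Some (~~ l.2).

Definition restrict (T : finType) (F : cnf T) (tau : passignment T) : cnf T :=
  [set [set l in (C : clause T) | ~~ lit_falsified tau l]
     | C in F & ~~ [exists l in (C : clause T), lit_satisfied tau l]].

Definition satisfiable (T : finType) (F : cnf T) : Prop :=
  exists s : T -> bool,
    forall C : clause T, C \in F -> exists2 l : literal T, l \in C & s l.1 = l.2.

(* In cnf (G + Y), inl v is the variable x_v and inr y is auxiliary. *)
Definition on_vertices (V Y : finType) (tau : V -> bool)
  : passignment (V + Y)%type :=
  fun x => match x with inl v => Some (tau v) | inr _ => None end.

Definition encodes_independent_set (G : sgraph) (Y : finType)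
    (F : cnf (G + Y)%type) : Prop :=
  forall tau : G -> bool,
    satisfiable (restrict F (on_vertices tau))
    <-> independent [set v : G | tau v].

Section IntervalGraph.
Variable n : nat.

Definition interval : finType :=
  {p : 'I_n.+1 * 'I_n.+1 | (1 <= p.1) && (p.1 < p.2)}.

Definition points (I : interval) : {set 'I_n.+1} :=
  [set k : 'I_n.+1 | (val I).1 <= k <= (val I).2].

Definition meets (I J : interval) : bool :=
  (I != J) && (points I :&: points J != set0).

Lemma meets_sym : symmetric meets.
Proof. by move=> I J; rewrite /meets eq_sym setIC. Qed.

Lemma meets_irrefl : irreflexive meets.
Proof. by move=> I; rewrite /meets eqxx. Qed.

Definition interval_graph : sgraph := SGraph meets_sym meets_irrefl.

End IntervalGraph.

(* Main.v *)
(* Two distinct intervals [i,j] and [k,l] with i <= k meet iff i = k or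
   i < k <= j. With auxiliary variables U i j ("some chosen [i,l] has j <= l")
   and Z i j ("no chosen interval starts in ]i,j]"), both cases are excluded by
   six implications per interval, which gives O(n^2) clauses and in particular
   the claimed bound. *)
Require Import Defs.
From mathcomp Require Import all_boot all_order all_algebra.
From mathcomp Require Import reals exp.
From mathcomp Require Import zify.

Set Implicit Arguments.
Unset Strict Implicit.
Unset Printing Implicit Defensive.

(** * Restriction as extension of assignments, and implication clauses *)

Definition extend (V Y : Type) (tau : V -> bool) (s : Y -> bool)
  (x : V + Y) : bool :=
  match x with inl v => tau v | inr y => s y end.

(** A vertex literal that [tau] does not falsify satisfies its clause, so the surviving clauses keep
    auxiliary literals only. The values of a satisfying assignment on vertex variables are thus
    immaterial and can be replaced by those of [tau]. *)
Lemma satisfiable_restrict (V Y : finType) (F : cnf (V + Y)%type)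
    (tau : V -> bool) :
  satisfiable (restrict F (on_vertices tau)) <->
  exists s : Y -> bool, forall C : clause (V + Y)%type, C \in F ->
    exists2 l : literal (V + Y)%type, l \in C & extend tau s l.1 = l.2.
Proof.
split=> [[s sP]|[s sP]].
  exists (fun y => s (inr y)) => C CF.
  have [/existsP[[[v|y] b] /andP[lC]]|unsat] :=
    boolP [exists l in C, lit_satisfied (on_vertices tau) l].
  - by move=> /eqP[tv]; exists (inl v, b).
  - by [].
  have CR : [set l in C | ~~ lit_falsified (on_vertices tau) l]
      \in restrict F (on_vertices tau).
    by apply/imsetP; exists C; rewrite // inE CF.
  have [[[v|y] b]] := sP _ CR; rewrite inE => /andP[lC lf] sl.
    case/negP: unsat; apply/existsP; exists (inl v, b); rewrite lC /=.
    move: lf; rewrite /lit_falsified /lit_satisfied /=.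
    by case: (tau v); case: {sl lC} b.
  by exists (inr y, b).
exists (extend tau s) => C' /imsetP[C]; rewrite inE => /andP[CF _] ->.
have [l lC sl] := sP _ CF; exists l; rewrite // inE lC /=.
by case: l sl {lC} => [[v|y] b] /= sl; rewrite /lit_falsified //= sl; case: b sl.
Qed.

Definition implication (T : finType) (p : T * literal T) : clause T :=
  [set (p.1, false); p.2].

Lemma implicationP (T : finType) (s : T -> bool) (p : T * literal T) :
  (exists2 l, l \in implication p & s l.1 = l.2) <->
  s p.1 ==> (s p.2.1 == p.2.2).
Proof.
split=> [[l /set2P[->|->] /= sl]|].
- by rewrite sl.
- by rewrite sl eqxx implybT.
have [sp /= /eqP sl|sp _] := boolP (s p.1).
  by exists p.2; rewrite ?set22.
by exists (p.1, false); rewrite ?set21 //=; apply: negbTE.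
Qed.

Section Encoding.
Variable n : nat.
Local Notation interval := (Defs.interval n).
Implicit Types I J K : interval.

(** * Intersection of intervals in terms of their endpoints *)

Definition left_end I : nat := (val I).1.
Definition right_end I : nat := (val I).2.

Lemma interval_bounds I : 0 < left_end I < right_end I /\ right_end I <= n.
Proof. by split; [case: I | rewrite -ltnS ltn_ord]. Qed.

Lemma interval_of_nat i j : 0 < i -> i < j -> j <= n ->
  exists I, left_end I = i /\ right_end I = j.
Proof.
move=> i0 ij jn.
have iK : @inord n i = i :> nat by rewrite inordK //; lia.
have jK : @inord n j = j :> nat by rewrite inordK //; lia.
have P : (1 <= (@inord n i, @inord n j).1)
  && ((@inord n i, @inord n j).1 < (@inord n i, @inord n j).2).
  by rewrite /= iK jK i0.
by exists (exist _ (inord i, inord j) P).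
Qed.

Lemma meetsE I J : meets I J =
  (I != J) && (maxn (left_end I) (left_end J)
               <= minn (right_end I) (right_end J)).
Proof.
rewrite /meets; congr (_ && _); apply/set0Pn/idP.
  move=> [k]; rewrite !inE -/(left_end I) -/(left_end J).
  by rewrite -/(right_end I) -/(right_end J); lia.
have [] := (interval_bounds I, interval_bounds J) => -[bI nI] [bJ nJ] le_IJ.
(* The larger left end serves as the common point. *)
exists (inord (maxn (left_end I) (left_end J))).
rewrite !inE inordK; last by lia.
by rewrite -/(left_end I) -/(left_end J) -/(right_end I) -/(right_end J); lia.
Qed.

Lemma interval_neqP I J :
  reflect (left_end I <> left_end J \/ right_end I <> right_end J) (I != J).
Proof.
apply: (iffP idP) => [IJ|neq]; last by apply/eqP => IJ; case: neq; rewrite IJ.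
have [eql|/eqP] := eqVneq (left_end I) (left_end J); last by left.
have [eqr|/eqP] := eqVneq (right_end I) (right_end J); last by right.
case/eqP: IJ; apply: val_inj.
by rewrite [val I]surjective_pairing [val J]surjective_pairing;
   congr pair; apply: val_inj.
Qed.

(** Both forbidden configurations are one-sided: as [I] and [J] range over ordered pairs, swapping
    them covers the mirrored cases. *)
Lemma independentP (tau : interval -> bool) :
  reflect (forall I J, tau I -> tau J ->
             ~ (left_end I = left_end J /\ right_end I < right_end J) /\
             ~ (left_end I < left_end J <= right_end I))
          (independent (G := interval_graph n) [set I | tau I]).
Proof.
have adjE I J : adj (s := interval_graph n) I J = meets I J by [].
apply: (iffP idP) => [ind I J tI tJ|H].
  have : ~~ meets I J.
    move/forallP/(_ I): ind; rewrite inE tI => /forallP/(_ J).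
    by rewrite inE tJ.
  rewrite meetsE; have [bI nI] := interval_bounds I.
  have [bJ nJ] := interval_bounds J => nm.
  split=> c; case/negP: nm; apply/andP; split; try (apply/interval_neqP; lia);
    lia.
apply/forallP=> I; apply/implyP; rewrite inE => tI.
apply/forallP=> J; apply/implyP; rewrite inE => tJ.
rewrite adjE meetsE; apply/negP=> /andP[/interval_neqP neq le_IJ].
have [] := (H I J tI tJ, H J I tJ tI); lia.
Qed.

(** * The clauses and their number *)

Definition aux : finType := (bool * ('I_n.+2 * 'I_n.+2))%type.
Local Notation var := (interval + aux)%type.

Definition X I : var := inl I.
(** Indices must reach [n.+1], because [constraints] mentions [U i j.+1] with [j <= n] and
    [U i.+1 i.+2] with [i < n]. In this range [inord] never falls back to its default value. *)
Definition U i j : var := inr (true, (inord i, inord j)).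
Definition Z i j : var := inr (false, (inord i, inord j)).

(** The second and fifth implications propagate [U] and [Z] by one index at a time, which keeps the
    number of clauses per interval constant. In the sixth, [U i.+1 i.+2] expresses that some chosen
    interval starts at [i.+1], since a right end exceeds its left end. *)
Definition constraints I : seq (var * literal var) :=
  let i := left_end I in let j := right_end I in
  [:: (X I, (U i j, true)); (U i j.+1, (U i j, true));
      (X I, (U i j.+1, false)); (X I, (Z i j, true));
      (Z i j, (Z i.+1 j, true)); (Z i j, (U i.+1 i.+2, false))].

Definition encoding : cnf var :=
  [set C in [seq implication p | J <- enum interval, p <- constraints J]].

(** Intervals are counted crudely as arbitrary pairs from ['I_n.+1]. *)
Lemma card_encoding : #|encoding| <= 6 * n.+1 ^ 2.
Proof.
rewrite cardsE (leq_trans (card_size _)) // size_allpairs_dep.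
have -> : [seq size (constraints J) | J <- enum interval]
        = nseq #|interval| 6.
  by rewrite cardE; elim: (enum _) => //= I s ->.
rewrite sumn_nseq leq_mul2l /= card_sig (leq_trans (max_card _)) //.
by rewrite card_prod card_ord.
Qed.

Lemma encodingP (s : var -> bool) :
  (forall C, C \in encoding -> exists2 l, l \in C & s l.1 = l.2) <->
  forall I, all (fun p => s p.1 ==> (s p.2.1 == p.2.2)) (constraints I).
Proof.
split=> [sat I|sat C].
  apply/allP=> p pI; apply/implicationP/sat; rewrite inE.
  by apply/allpairsPdep; exists I, p; rewrite mem_enum.
rewrite inE => /allpairsPdep[I [p [_ pI ->]]].
by apply/implicationP; move/allP: (sat I); apply.
Qed.

(** For equal left ends, the [U] forced by the longer interval descends to the one that the shorter
    interval forbids. For left ends [i < k <= j], [Z i j] advances to [Z k.-1 j] and forbids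
    [U k k.+1], which the interval starting at [k] forces. *)
Lemma encoding_sound (s : var -> bool) :
  (forall I, all (fun p => s p.1 ==> (s p.2.1 == p.2.2)) (constraints I)) ->
  independent (G := interval_graph n) [set I | s (X I)].
Proof.
move=> sat.
have XU I : s (X I) -> s (U (left_end I) (right_end I)).
  by move=> sI; have /and5P[] := sat I; rewrite sI /= => /eqP.
have XnU I : s (X I) -> ~~ s (U (left_end I) (right_end I).+1).
  by move=> sI; have /and4P[_ _] := sat I; rewrite sI /= => /eqP->.
have XZ I : s (X I) -> s (Z (left_end I) (right_end I)).
  by move=> sI; have /and5P[_ _ _] := sat I; rewrite sI /= => /eqP.
have Ustep i j : 0 < i -> i < j -> j <= n -> s (U i j.+1) -> s (U i j).
  move=> i0 ij jn sU; have [I [Ii Ij]] := interval_of_nat i0 ij jn.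
  by have /and3P[_] := sat I; rewrite Ii Ij sU /= => /eqP.
have Ule i j l : 0 < i -> i < j -> j <= l -> l <= n.+1 ->
    s (U i l) -> s (U i j).
  move=> i0 ij; elim: l => [|l IHl]; first by lia.
  rewrite leq_eqVlt => /orP[/eqP-> //|jl] ln sUl.
  by apply: IHl; [lia|lia|apply: Ustep => //; lia].
have ZnU i j : 0 < i -> i < j -> j <= n -> s (Z i j) -> ~~ s (U i.+1 i.+2).
  move=> i0 ij jn sZ; have [I [Ii Ij]] := interval_of_nat i0 ij jn.
  by have /and5P[_ _ _ _] := sat I; rewrite Ii Ij sZ /= => /andP[_] /andP[/eqP->].
have Zstep i j : 0 < i -> i < j -> j <= n -> s (Z i j) -> s (Z i.+1 j).
  move=> i0 ij jn sZ; have [I [Ii Ij]] := interval_of_nat i0 ij jn.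
  by have /and5P[_ _ _ _] := sat I; rewrite Ii Ij sZ /= => /andP[/eqP].
have Zle i k j : 0 < i -> i <= k -> k <= j -> j <= n -> s (Z i j) -> s (Z k j).
  move=> i0; elim: k => [|k IHk]; first by lia.
  rewrite leq_eqVlt => /orP[/eqP-> //|ik] kj jn sZ.
  by apply: Zstep; [lia|lia|lia|apply: IHk => //; lia].
apply/independentP=> I J sI sJ.
have [bI nI] := interval_bounds I; have [bJ nJ] := interval_bounds J.
split=> [[eqi ltj]|/andP[ltij leij]].
  case/negP: (XnU I sI); apply: (Ule _ _ (right_end J)); [lia..|].
  by rewrite eqi; apply: XU.
(* The sixth implication at [i] concerns left end [i.+1], so [Z] is advanced only to the predecessor
   of [left_end J]. *)
have JK : (left_end J).-1.+1 = left_end J by lia.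
have sZ : s (Z (left_end J).-1 (right_end I)).
  by apply: (Zle (left_end I)); [lia..|apply: XZ].
have := ZnU _ _ _ _ nI sZ; rewrite JK => nU.
suff sU : s (U (left_end J) (left_end J).+1) by rewrite sU in nU; lia.
by apply: (Ule _ _ (right_end J)); [lia..|apply: XU].
Qed.

(** * Auxiliary values for an independent set *)

Definition intended (tau : interval -> bool) (y : aux) : bool :=
  if y.1 then
    [exists K, [&& tau K, left_end K == y.2.1 :> nat & y.2.2 <= right_end K]]
  else [forall K, tau K ==> ~~ (y.2.1 < left_end K <= y.2.2)].

Lemma intendedU (tau : interval -> bool) i j : i <= n.+1 -> j <= n.+1 ->
  reflect (exists K, [/\ tau K, left_end K = i & j <= right_end K])
          (extend tau (intended tau) (U i j)).
Proof.
move=> ni nj; rewrite /= /intended /= !inordK //.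
apply: (iffP existsP) => -[K]; first by case/and3P=> ? /eqP ? ?; exists K.
by case=> tK Ki jK; exists K; rewrite tK Ki eqxx.
Qed.

Lemma intendedZ (tau : interval -> bool) i j : i <= n.+1 -> j <= n.+1 ->
  reflect (forall K, tau K -> ~ (i < left_end K <= j))
          (extend tau (intended tau) (Z i j)).
Proof.
move=> ni nj; rewrite /= /intended /= !inordK //.
apply: (iffP forallP) => H K; first by move=> tK; apply/negP/(implyP (H K)).
by apply/implyP=> tK; apply/negP/H.
Qed.

(** Independence enters in the third and fourth implications. The others follow from the meanings of
    [U] and [Z]: lowering [j] weakens [U i j], raising [i] weakens [Z i j], and [i.+1] lies in
    []i,j]]. *)
Lemma encoding_complete (tau : interval -> bool) I :
  independent (G := interval_graph n) [set J | tau J] ->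
  all (fun p => extend tau (intended tau) p.1
                ==> (extend tau (intended tau) p.2.1 == p.2.2)) (constraints I).
Proof.
move=> /independentP ind; have [bI nI] := interval_bounds I.
have [Ui Zi] := (@intendedU tau, @intendedZ tau).
have X_I : extend tau (intended tau) (X I) = tau I by [].
(* Abstracting the assignment leaves only its values on the three kinds of variables. *)
move: (extend _ _) Ui Zi X_I => s Ui Zi X_I.
rewrite /constraints /= X_I !andbT; do 5?[apply/andP; split]; apply/implyP.
- by move=> tI; apply/eqP/Ui; [lia..|exists I].
- move=> /Ui[||K [tK Ki jK]]; [lia..|].
  by apply/eqP/Ui; [lia..|exists K; split=> //; lia].
- move=> tI; rewrite eqbF_neg; apply/negP=> /Ui[||K [tK Ki jK]]; [lia..|].
  by case: (ind I K tI tK) => -[].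
- by move=> tI; apply/eqP/Zi; [lia..|move=> K tK; case: (ind I K tI tK)].
- move=> /Zi Zij; apply/eqP/Zi; [lia..|] => K tK.
  by have := Zij _ _ K tK; lia.
- move=> /Zi Zij; rewrite eqbF_neg; apply/negP=> /Ui[||K [tK Ki jK]]; [lia..|].
  by have := Zij _ _ K tK; lia.
Qed.

Lemma encoding_correct : encodes_independent_set (G := interval_graph n) encoding.
Proof.
move=> tau; rewrite satisfiable_restrict; split=> [[s /encodingP sat]|ind].
  exact: encoding_sound sat.
exists (intended tau); apply/encodingP => I; exact: encoding_complete.
Qed.

End Encoding.

Import Order.TTheory GRing.Theory Num.Theory.

Theorem theorem21 (R : realType) (n : nat) (hn : (2 <= n)%N) :
  exists (Y : finType) (F : cnf (interval_graph n + Y)%type),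
    encodes_independent_set F /\
    (#|F|%:R <= 26 * n%:R ^+ 2 * (ln n%:R / ln 2) :> R)%R.
Proof.
exists (aux n), (encoding n); split; first exact: encoding_correct.
have ln2_gt0 : (0 < ln 2 :> R)%R by rewrite ln_gt0 // ltr1n.
have log_ge1 : (1 <= ln n%:R / ln 2 :> R)%R.
  by rewrite ler_pdivlMr // mul1r ler_ln ?posrE ?ltr0n ?ler_nat //; lia.
(* As the logarithm is at least 1, a quadratic bound suffices. *)
apply: (@le_trans _ _ (26 * n%:R ^+ 2)%R); last first.
  by rewrite ler_peMr // mulr_ge0 // exprn_ge0.
rewrite -natrX -natrM ler_nat (leq_trans (card_encoding n)) //.
(* From [n >= 2], [n + 1] is at most [3n/2], so [6(n+1)^2] is at most [27n^2/2]. *)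
nia.
Qed.
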